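(* Let $b_0,b_1\in\mathbb{Q}_2$ be such that $F=(b_0x,\ 1+b_1x)$ and $G=(b_1x,\ 1+b_0x)$ are (linear-polynomial) $2$-adic systems, and let $\sigma:\{0,1\}\to\{0,1\}$, $0\mapsto1$, $1\mapsto0$. Then $$\pi_{F,\sigma,G}(n)=\frac{1+n(b_1-2)}{2-b_0}$$ for all $n\in\mathbb{Z}_2$. In particular, if $b_0,b_1\in\mathbb{Q}\cap\mathbb{Z}_2$, then $\pi_{F,\sigma,G}(\mathbb{Q}\cap\mathbb{Z}_2)=\mathbb{Q}\cap\mathbb{Z}_2$, and consequently $F$ is ultimately periodic on $\mathbb{Q}\cap\mathbb{Z}_2$ if and only if $G$ is ultimately periodic on $\mathbb{Q}\cap\mathbb{Z}_2$.
   Context: For $a=\sum_{i\ge0}a_i2^i\in\mathbb{Z}_2$ with $a_i\in\{0,1\}$ let $a\,\%\,2:=a_0$. A $2$-fibred function with domain $\mathbb{Z}_2$ is a pair $F=(F[0],F[1])$ of functions $\mathbb{Z}_2\to\mathbb{Z}_2$, regarded also as a function $F:\mathbb{Z}_2\to\mathbb{Z}_2$ by $F(n)=\dfrac{F[n\%2](n)-(F[n\%2](n)\,\%\,2)}{2}$. Only the values of $F[r]$ on $r+2\mathbb{Z}_2$ matter; $F=(a_0+b_0x,a_1+b_1x)$ means that $F[r]$ agrees on $r+2\mathbb{Z}_2$ with the polynomial $a_r+b_rx$ for $r=0,1$ (such $F$ are called linear-polynomial). The $F$-digit expansion of $n$ is $\psi_F(n):=(F^k(n)\,\%\,2)_{k\ge0}$.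 $F$ is a $2$-adic system if for all integers $k\ge0$ and all $m,n\in\mathbb{Z}_2$: $m\equiv n\pmod{2^k}$ if and only if the first $k$ entries of $\psi_F(m)$ and $\psi_F(n)$ coincide. Then $\psi_F$ is a bijection from $\mathbb{Z}_2$ onto the set of infinite $0$-$1$-sequences. For $2$-adic systems $F,G$ and a bijection $\sigma$ of $\{0,1\}$, extended entry-wise to sequences, $\pi_{F,\sigma,G}:=\psi_G^{-1}\circ\sigma\circ\psi_F:\mathbb{Z}_2\to\mathbb{Z}_2$. A $2$-adic system $F$ is ultimately periodic on a set $A$ if $\{n\in\mathbb{Z}_2\mid\psi_F(n)\text{ is ultimately periodic}\}=A$ (purely periodic sequences count as ultimately periodic). *)

(* Defs.v *)
From HB Require Import structures.
From mathcomp Require Import all_boot all_order all_algebra.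
From mathcomp Require Import boolp classical_sets.

Set Implicit Arguments.
Unset Strict Implicit.
Unset Printing Implicit Defensive.

Import GRing.Theory.
Local Open Scope classical_set_scope.
Local Open Scope ring_scope.

(* Z_2 as the inverse limit of the rings Z/2^k: [res a k] is the
   representative in {0, ..., 2^k - 1} of the class of a modulo 2^k. *)
Definition compatible (u : nat -> nat) : bool :=
  `[< forall k, u k = (u k.+1 %% 2 ^ k)%N >].

Record Z2 := MkZ2 { res :> nat -> nat; res_compatible : compatible res }.

HB.instance Definition _ := [isSub for res].
HB.instance Definition _ := [Choice of Z2 by <:].

Lemma resS (a : Z2) k : a k = (a k.+1 %% 2 ^ k)%N.
Proof. by move: k; apply/asboolP; exact: res_compatible. Qed.

Lemma res_modn (a : Z2) k : (a k %% 2 ^ k)%N = a k.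
Proof. by rewrite resS modn_mod. Qed.

Lemma res_lt (a : Z2) k : (a k < 2 ^ k)%N.
Proof. by rewrite resS ltn_mod expn_gt0. Qed.

Lemma Z2P (a b : Z2) : (forall k, a k = b k) -> a = b.
Proof. by move=> ab; apply/val_inj/funext. Qed.

Lemma modn_exp2S m k : ((m %% 2 ^ k.+1) %% 2 ^ k = m %% 2 ^ k)%N.
Proof. by rewrite modn_dvdm // dvdn_exp2l. Qed.

Lemma eqmod_resS (a : Z2) k : a k.+1 = a k %[mod 2 ^ k].
Proof. by rewrite [in RHS]resS modn_mod. Qed.

Lemma Z2_of_subproof (f : nat -> nat) :
  (forall k, f k.+1 = f k %[mod 2 ^ k]) ->
  compatible (fun k => f k %% 2 ^ k)%N.
Proof. by move=> fP; apply/asboolP => k; rewrite modn_exp2S fP. Qed.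

Definition Z2_of f (fP : forall k, f k.+1 = f k %[mod 2 ^ k]) : Z2 :=
  MkZ2 (Z2_of_subproof fP).

Lemma Z2_nat_subproof (n k : nat) : n = n %[mod 2 ^ k].
Proof. by []. Qed.
Definition Z2_nat (n : nat) : Z2 := @Z2_of (fun=> n) (Z2_nat_subproof n).

Lemma Z2_add_subproof (a b : Z2) k :
  (a k.+1 + b k.+1 = a k + b k %[mod 2 ^ k])%N.
Proof. by rewrite -modnDm !eqmod_resS modnDm. Qed.
Definition Z2_add (a b : Z2) : Z2 := Z2_of (Z2_add_subproof a b).

Lemma Z2_mul_subproof (a b : Z2) k :
  (a k.+1 * b k.+1 = a k * b k %[mod 2 ^ k])%N.
Proof. by rewrite -modnMm !eqmod_resS modnMm. Qed.
Definition Z2_mul (a b : Z2) : Z2 := Z2_of (Z2_mul_subproof a b).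

Lemma Z2_opp_subproof (a : Z2) k :
  (2 ^ k.+1 - a k.+1 = 2 ^ k - a k %[mod 2 ^ k])%N.
Proof.
apply/eqP; rewrite -(eqn_modDr (a k)) subnK ?(ltnW (res_lt _ _)) // modnn.
rewrite -modnDmr -(eqmod_resS a) modnDmr subnK ?(ltnW (res_lt _ _)) //.
by rewrite expnS modnMl.
Qed.
Definition Z2_opp (a : Z2) : Z2 := Z2_of (Z2_opp_subproof a).

Lemma Z2_addA : associative Z2_add.
Proof. by move=> a b c; apply: Z2P => k /=; rewrite modnDml modnDmr addnA. Qed.

Lemma Z2_addC : commutative Z2_add.
Proof. by move=> a b; apply: Z2P => k /=; rewrite addnC. Qed.

Lemma Z2_add0 : left_id (Z2_nat 0) Z2_add.
Proof. by move=> a; apply: Z2P => k /=; rewrite mod0n add0n res_modn. Qed.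

Lemma Z2_addN : left_inverse (Z2_nat 0) Z2_opp Z2_add.
Proof.
move=> a; apply: Z2P => k /=.
by rewrite modnDml subnK ?modnn ?mod0n // (ltnW (res_lt _ _)).
Qed.

HB.instance Definition _ :=
  GRing.isZmodule.Build Z2 Z2_addA Z2_addC Z2_add0 Z2_addN.

Lemma Z2_mulA : associative Z2_mul.
Proof. by move=> a b c; apply: Z2P => k /=; rewrite modnMml modnMmr mulnA. Qed.

Lemma Z2_mulC : commutative Z2_mul.
Proof. by move=> a b; apply: Z2P => k /=; rewrite mulnC. Qed.

Lemma Z2_mul1 : left_id (Z2_nat 1) Z2_mul.
Proof. by move=> a; apply: Z2P => k /=; rewrite modnMml mul1n res_modn. Qed.

Lemma Z2_mulD : left_distributive Z2_mul Z2_add.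
Proof.
by move=> a b c; apply: Z2P => k /=; rewrite modnMml modnDm mulnDl.
Qed.

Lemma Z2_oner_neq0 : Z2_nat 1 != 0.
Proof. by apply/eqP => /(congr1 (fun a : Z2 => a 1%N)). Qed.

HB.instance Definition _ := GRing.Zmodule_isComNzRing.Build Z2
  Z2_mulA Z2_mulC Z2_mul1 Z2_mulD Z2_oner_neq0.

Definition Z2_unit : {pred Z2} := fun a => `[< exists b : Z2, b * a = 1 >].

Definition Z2_inv (a : Z2) : Z2 := xget a [set b | b * a = 1].

Lemma Z2_mulVr : {in Z2_unit, left_inverse 1 Z2_inv *%R}.
Proof. by move=> a /asboolP ha; exact: (@xgetPex _ a [set b | b * a = 1]). Qed.

Lemma Z2_unitPl (a b : Z2) : b * a = 1 -> Z2_unit a.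
Proof. by move=> ba; apply/asboolP; exists b. Qed.

Lemma Z2_invr_out : {in [predC Z2_unit], Z2_inv =1 id}.
Proof.
move=> a /asboolPn ha; rewrite /Z2_inv; case: xgetP => // b _ ba.
by case: ha; exists b.
Qed.

HB.instance Definition _ := GRing.ComNzRing_hasMulInverse.Build Z2
  Z2_mulVr Z2_unitPl Z2_invr_out.

Lemma res_le (a : Z2) k l : (k <= l)%N -> a k = (a l %% 2 ^ k)%N.
Proof.
elim: l => [|l IHl]; first by rewrite leqn0 => /eqP ->; rewrite res_modn.
rewrite leq_eqVlt => /predU1P[-> | kl]; first by rewrite res_modn.
by rewrite (IHl kl) [a l]resS modn_dvdm // dvdn_exp2l.
Qed.

Lemma Z2_neq0P (a : Z2) : a != 0 -> exists k, a k <> 0%N.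
Proof.
move=> a0; apply/existsNP => ha; move/eqP: a0; apply.
by apply: Z2P => k; rewrite ha /= mod0n.
Qed.

Lemma Z2_integral : GRing.integral_domain_axiom Z2.
Proof.
move=> a b ab; apply/negPn/negP; rewrite negb_or => /andP[].
move=> /Z2_neq0P[k ak] /Z2_neq0P[l bl].
have := congr1 (fun c : Z2 => c (k + l)%N) ab; rewrite /= mod0n => /eqP abkl.
have ndvd_a : ~~ (2 ^ k %| a (k + l))%N.
  by rewrite /dvdn -res_le ?leq_addr //; apply/eqP.
have ndvd_b : ~~ (2 ^ l %| b (k + l))%N.
  by rewrite /dvdn -res_le ?leq_addl //; apply/eqP.
have a_gt0 : (0 < a (k + l))%N.
  by rewrite lt0n; apply: contraNneq ndvd_a => ->; rewrite dvdn0.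
have b_gt0 : (0 < b (k + l))%N.
  by rewrite lt0n; apply: contraNneq ndvd_b => ->; rewrite dvdn0.
move: abkl; rewrite -[_ == _]/(2 ^ (k + l) %| _)%N.
rewrite pfactor_dvdn ?muln_gt0 ?a_gt0 // lognM //.
move: ndvd_a ndvd_b; rewrite !pfactor_dvdn // -!ltnNge => la lb.
by apply/negP; rewrite -ltnNge -addSn leq_add // ltnW.
Qed.

HB.instance Definition _ := GRing.ComUnitRing_isIntegral.Build Z2 Z2_integral.

Definition Q2 := {fraction Z2}.

Definition Z2toQ2 (a : Z2) : Q2 := FracField.tofrac a.

HB.instance Definition _ :=
  GRing.RMorphism.copy Z2toQ2 (@FracField.tofrac Z2).

(* The binary digits of a = \sum_i (digit a i) 2^i. *)
Definition digit (a : Z2) (i : nat) : bool := odd (a i.+1 %/ 2 ^ i).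

Lemma res_digit (a : Z2) k : a k = (\sum_(i < k) digit a i * 2 ^ i)%N.
Proof.
elim: k => [|k IHk]; first by rewrite big_ord0 -res_modn modn1.
rewrite big_ord_recr /= -IHk {1}(divn_eq (a k.+1) (2 ^ k)) -resS addnC /digit.
congr (_ + _ * _)%N; have : (a k.+1 %/ 2 ^ k < 2)%N.
  by rewrite ltn_divLR ?expn_gt0 // -expnS res_lt.
by case: (_ %/ _)%N => [|[|]].
Qed.

Definition mod2 (a : Z2) : bool := digit a 0.

(* Z2_half a = (a - a % 2) / 2, computed on residues; see Z2_half_spec. *)
Lemma Z2_half_subproof (a : Z2) : compatible (fun k => a k.+1 %/ 2)%N.
Proof. by apply/asboolP => k; rewrite modn_divl -expnSr -resS. Qed.
Definition Z2_half (a : Z2) : Z2 := MkZ2 (Z2_half_subproof a).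

Lemma Z2_natE n : n%:R = Z2_nat n :> Z2.
Proof.
elim: n => [|n IHn]; first exact: Z2P.
by rewrite mulrS IHn; apply: Z2P => k /=; rewrite modnDm add1n.
Qed.

Lemma Z2_half_spec (a : Z2) : 2 * Z2_half a = a - (mod2 a)%:R.
Proof.
apply/eqP; rewrite eq_sym subr_eq !Z2_natE; apply/eqP/Z2P => k /=.
rewrite modnMml modnDm /mod2 /digit expn0 divn1.
have -> : odd (a 1%N) = odd (a k.+1).
  by rewrite (@res_le a 1 k.+1) // expn1 modn2 oddb.
by rewrite mulnC divn2 muln2 addnC odd_double_half -resS.
Qed.

Definition congr_exp2 (k : nat) (m n : Z2) : Prop :=
  exists c : Z2, m - n = 2 ^+ k * c.

(* The digits 0, 1 are the booleans false, true. *)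
Definition fibred := bool -> Z2 -> Z2.

Definition fibred_fun (F : fibred) (n : Z2) : Z2 := Z2_half (F (mod2 n) n).

Definition linear_polynomial (F : fibred) (a0 b0 a1 b1 : Q2) : Prop :=
  forall n : Z2,
    Z2toQ2 (F (mod2 n) n) =
      if mod2 n then a1 + b1 * Z2toQ2 n else a0 + b0 * Z2toQ2 n.

Definition psi (F : fibred) (n : Z2) : nat -> bool :=
  fun k => mod2 (iter k (fibred_fun F) n).

Definition two_adic_system (F : fibred) : Prop :=
  forall (k : nat) (m n : Z2),
    congr_exp2 k m n <-> (forall i, (i < k)%N -> psi F m i = psi F n i).

(* For a 2-adic system G, psi G is a bijection onto nat -> bool, and psi_inv G
   is its inverse. *)
Definition psi_inv (G : fibred) (s : nat -> bool) : Z2 :=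
  xget 0 [set n | psi G n = s].

Definition pi_conj (F : fibred) (sigma : bool -> bool) (G : fibred) : Z2 -> Z2 :=
  fun n => psi_inv G (sigma \o psi F n).

Definition ultimately_periodic (s : nat -> bool) : Prop :=
  exists N p : nat, (0 < p)%N /\ forall k, (N <= k)%N -> s (k + p)%N = s k.

Definition ultimately_periodic_on (F : fibred) (A : set Z2) : Prop :=
  [set n | ultimately_periodic (psi F n)] = A.

Definition rationals : set Q2 := range (ratr : rat -> Q2).

Definition rational_Z2 : set Z2 := [set n | rationals (Z2toQ2 n)].

(* Main.v *)
Require Import Defs.
From mathcomp Require Import all_boot all_order all_algebra.
From mathcomp Require Import boolp classical_sets.
From mathcomp Require Import ring.

Import GRing.Theory.
Local Open Scope classical_set_scope.
Local Open Scope ring_scope.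

(* In a 2-adic system with a branch b x on even integers, b is a 2-adic
   integer and a unit; so 2 - b0 and 2 - b1 are units too, and the affine map
   h(n) = (1 - n (2 - b1)) / (2 - b0) acts on Z_2, flips the parity and
   satisfies G (h n) = h (F n).  Hence psi_G (h n) is the complement of
   psi_F n.  Exchanging b0 and b1 turns h into its inverse, and both maps
   preserve rationality. *)

(** * Parity and units in Z_2 *)

Lemma mod2E (a : Z2) : mod2 a = odd (a 1%N).
Proof. by rewrite /mod2 /digit expn0 divn1. Qed.

Lemma mod2D (a b : Z2) : mod2 (a + b) = mod2 a (+) mod2 b.
Proof. by rewrite !mod2E /= expn1 modn2 oddb oddD. Qed.

Lemma mod2M (a b : Z2) : mod2 (a * b) = mod2 a && mod2 b.
Proof. by rewrite !mod2E /= expn1 modn2 oddb oddM. Qed.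

Lemma mod2_nat n : mod2 n%:R = odd n.
Proof. by rewrite Z2_natE mod2E /= expn1 modn2 oddb. Qed.

Lemma mod2N (a : Z2) : mod2 (- a) = mod2 a.
Proof.
have := mod2D a (- a); rewrite subrr (mod2_nat 0).
by case: (mod2 a) (mod2 (- a)) => [] [].
Qed.

Lemma mod2B (a b : Z2) : mod2 (a - b) = mod2 a (+) mod2 b.
Proof. by rewrite mod2D mod2N. Qed.

Lemma mod2_2sub (a : Z2) : mod2 (2 - a) = mod2 a.
Proof. by rewrite mod2B (mod2_nat 2). Qed.

Lemma mod2_2mul (a : Z2) : mod2 (2 * a) = false.
Proof. by rewrite mod2M (mod2_nat 2). Qed.

Lemma half_even (a : Z2) : ~~ mod2 a -> 2 * Z2_half a = a.
Proof. by rewrite Z2_half_spec => /negbTE->; rewrite subr0. Qed.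

(** An odd residue is coprime to 2^k, hence invertible modulo 2^k; since such inverses are unique,
    arbitrary choices at each level are compatible and define an element of the inverse limit. *)
Lemma mod2_unit (a : Z2) : mod2 a -> a \is a GRing.unit.
Proof.
move=> a_odd.
have inv k : exists u, (u * a k = 1 %[mod 2 ^ k])%N.
  (* Level 0 is separate: the residue modulo 1 is 0, which is not odd. *)
  case: k => [|k]; first by exists 0%N; rewrite !modn1.
  have ak_odd : odd (a k.+1).
    by move: a_odd; rewrite mod2E (@res_le a 1 k.+1) // expn1 modn2 oddb.
  have [u v e _] := egcdnP (2 ^ k.+1) (odd_gt0 ak_odd).
  have /eqP cop : coprime (a k.+1) (2 ^ k.+1) by rewrite coprimeXr // coprimen2.
  by exists u; rewrite e cop modnMDl.
have [f fP] := choice inv.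
have f_compat k : (f k.+1 = f k %[mod 2 ^ k])%N.
  (* [f k.+1] also inverts [a k] modulo 2^k; evaluating [f k.+1 * f k * a k] in two ways then gives
     the congruence. *)
  have fSP : (f k.+1 * a k = 1 %[mod 2 ^ k])%N.
    by rewrite -modnMmr -eqmod_resS modnMmr -modn_exp2S fP modn_exp2S.
  rewrite -[f k.+1]muln1 -modnMmr -fP modnMmr mulnCA -modnMmr fSP modnMmr.
  by rewrite muln1.
apply/unitrP; exists (Z2_of f_compat).
suff e : Z2_of f_compat * a = 1 by rewrite [X in _ /\ X = _]mulrC e.
by apply: Z2P => k /=; rewrite modnMml fP.
Qed.

(** Because n < 2^n, the residue of n at level n is n itself. *)
Lemma Z2_natr_eq0 n : (n%:R == 0 :> Z2) = (n == 0%N).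
Proof.
apply/eqP/eqP => [|-> //]; rewrite Z2_natE => /(congr1 (fun a : Z2 => a n)) /=.
by rewrite mod0n modn_small // ltn_expl.
Qed.

Lemma congr_exp2_res k (m n : Z2) : congr_exp2 k m n -> m k = n k.
Proof.
case=> c /eqP; rewrite subr_eq => /eqP ->.
by rewrite -natrX Z2_natE /= modnn mul0n mod0n add0n res_modn.
Qed.

(** * The embedding into Q_2 and the rational elements *)

Lemma Z2toQ2_eq0 (a : Z2) : (Z2toQ2 a == 0) = (a == 0).
Proof. exact: tofrac_eq0. Qed.

Lemma Z2toQ2_inj : injective Z2toQ2.
Proof. by move=> a b /eqP; rewrite tofrac_eq => /eqP. Qed.

Lemma Q2_intr_eq0 (p : int) : (p%:~R == 0 :> Q2) = (p == 0).
Proof.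
rewrite -(rmorph_int Z2toQ2) Z2toQ2_eq0; case: p => n; first exact: Z2_natr_eq0.
by rewrite NegzE mulrNz !oppr_eq0 -[n.+1%:~R]/(n.+1%:R) Z2_natr_eq0.
Qed.

(** Allowing unreduced fractions turns closure under field operations into plain computation. *)
Lemma rationalsP (x : Q2) :
  rationals x <-> exists p q : int, q != 0 /\ x = p%:~R / q%:~R.
Proof.
split=> [[r _ <-]|[p [q [q0 ->]]]]; first by exists (numq r), (denq r).
exists (p%:~R / q%:~R) => //; rewrite /ratr.
set r := (p%:~R / q%:~R : rat).
apply/eqP; rewrite eqr_div ?Q2_intr_eq0 ?denq_neq0 // -!rmorphM /=.
(* Cross-multiplication leaves an identity of integers, which is checked in [rat]. *)
suff -> : numq r * q = p * denq r by [].
apply: (@intr_inj rat); rewrite !rmorphM /= numqE mulrAC divfK //.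
by rewrite intr_eq0.
Qed.

Lemma rationals_nat n : rationals n%:R.
Proof. by apply/rationalsP; exists n, 1; rewrite divr1. Qed.

Lemma rationalsB (x y : Q2) : rationals x -> rationals y -> rationals (x - y).
Proof.
move=> /rationalsP[p [q [q0 ->]]] /rationalsP[r [s [s0 ->]]].
apply/rationalsP; exists (p * s - r * q), (q * s); split.
  by rewrite mulf_neq0.
rewrite -Q2_intr_eq0 in q0; rewrite -Q2_intr_eq0 in s0.
rewrite -mulNr addf_div; [|exact: q0|exact: s0].
by rewrite rmorphB !(rmorphM _ p, rmorphM _ q, rmorphM _ r) mulNr.
Qed.

Lemma rationalsM (x y : Q2) : rationals x -> rationals y -> rationals (x * y).
Proof.
move=> /rationalsP[p [q [q0 ->]]] /rationalsP[r [s [s0 ->]]].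
apply/rationalsP; exists (p * r), (q * s); split; first by rewrite mulf_neq0.
by rewrite !rmorphM /= invfM mulrACA.
Qed.

Lemma rationalsV (x : Q2) : rationals x -> rationals x^-1.
Proof.
move=> /rationalsP[p [q [q0 ->]]]; apply/rationalsP; rewrite invf_div.
(* As 0^-1 = 0, the case p = 0 is represented by 0/1 instead of q/p. *)
have [->|p0] := eqVneq p 0; last by exists q, p.
by exists 0, 1; rewrite !mulr0z invr0 mulr0 mul0r.
Qed.

(** * Digit expansions and the coefficients they allow *)

Lemma psi_inj (F : fibred) : two_adic_system F -> injective (psi F).
Proof.
move=> sysF m n mn; apply: Z2P => k; apply: congr_exp2_res.
by apply/sysF => i _; rewrite mn.
Qed.

(** [psi_inv] selects some point with the given expansion; n is one, and injectivity leaves no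
    other. *)
Lemma psiK (F : fibred) : two_adic_system F -> cancel (psi F) (psi_inv F).
Proof.
move=> sysF n; apply: psi_inj => //.
exact: (@xgetPex _ 0 [set m | psi F m = psi F n]) (ex_intro _ n erefl).
Qed.

(* F(4) and F(0) = 0 have the same parity, so 2 b = F[0](2) is even; F(2) and
   F(0) have different parities, so b = F(2) is odd. *)
Lemma even_coef_odd (F : fibred) (a1 b b1 : Q2) :
  linear_polynomial F 0 b a1 b1 -> two_adic_system F ->
  exists2 c : Z2, mod2 c & b = Z2toQ2 c.
Proof.
move=> hF sysF.
have Fv (n : Z2) : mod2 n = false -> Z2toQ2 (F false n) = b * Z2toQ2 n.
  by move=> n0; have := hF n; rewrite n0 add0r.
pose c := F false 2.
have cE : Z2toQ2 c = b * 2 by rewrite Fv ?(mod2_nat 2) // rmorph_nat.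
have F0 : F false 0 = 0.
  by apply: Z2toQ2_inj; rewrite Fv ?(mod2_nat 0) // rmorph0 mulr0.
have F4 : F false 4 = 2 * c.
  apply: Z2toQ2_inj; rewrite Fv ?(mod2_nat 4) // rmorphM !rmorph_nat /= cE.
  by ring.
have two_neq0 : 2 != 0 :> Z2 by rewrite Z2_natr_eq0.
have half2 a : Z2_half (2 * a) = a.
  by apply: (mulfI two_neq0); rewrite half_even // mod2_2mul.
have half0 : Z2_half 0 = 0 by rewrite -[X in Z2_half X](mulr0 2) half2.
have c_even : ~~ mod2 c.
  have /sysF/(_ 1%N isT) : congr_exp2 2 4 0 by exists 1; ring.
  rewrite /psi /= /fibred_fun (mod2_nat 4) (mod2_nat 0) F4 F0 half2 half0.
  by rewrite (mod2_nat 0) => ->.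
have bE : b = Z2toQ2 (Z2_half c).
  apply: (@mulIf _ 2); first by rewrite -(rmorph_nat Z2toQ2) Z2toQ2_eq0.
  by rewrite -cE -[in LHS](half_even c c_even) rmorphM rmorph_nat mulrC.
exists (Z2_half c) => //; apply: contraT => d_even.
(* If [Z2_half c] were even, 2 and 0 would share two digits, although they differ modulo 4. *)
have /sysF/congr_exp2_res : forall i, (i < 2)%N -> psi F 2 i = psi F 0 i.
  case=> [|[|//]] _; rewrite /psi /=.
    by rewrite (mod2_nat 0) (mod2_nat 2).
  rewrite /fibred_fun (mod2_nat 2) (mod2_nat 0) F0 half0 (mod2_nat 0).
  exact: negbTE.
by rewrite Z2_natE.
Qed.

(** * The affine conjugacy *)

Definition affine_conj (c0 c1 n : Z2) : Z2 := (1 - n * (2 - c1)) / (2 - c0).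

Lemma unit_2sub (c : Z2) : mod2 c -> 2 - c \is a GRing.unit.
Proof. by move=> c_odd; rewrite mod2_unit // mod2_2sub. Qed.

Lemma affine_conj_mul (c0 c1 n : Z2) : mod2 c0 ->
  affine_conj c0 c1 n * (2 - c0) = 1 - n * (2 - c1).
Proof. by move=> /unit_2sub u0; rewrite divrK. Qed.

(** For m the image of n, the defining relation m (2 - c0) + n (2 - c1) = 1 is symmetric under
    swapping (m, c0) with (n, c1). *)
Lemma affine_conjK (c0 c1 : Z2) :
  mod2 c0 -> mod2 c1 -> cancel (affine_conj c0 c1) (affine_conj c1 c0).
Proof.
move=> odd0 /unit_2sub u1 n.
by rewrite [LHS]/affine_conj affine_conj_mul // subKr mulrK.
Qed.

(** Modulo 2 the same relation reads m + n = 1, as 2 - c0 and 2 - c1 are odd. *)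
Lemma mod2_affine_conj (c0 c1 n : Z2) :
  mod2 c0 -> mod2 c1 -> mod2 (affine_conj c0 c1 n) = ~~ mod2 n.
Proof.
move=> odd0 odd1.
have := congr1 mod2 (affine_conj_mul c0 c1 n odd0).
rewrite mod2B (mod2_nat 1) !mod2M !mod2_2sub.
by rewrite odd0 odd1 !andbT.
Qed.

Lemma Z2toQ2_affine_conj (c0 c1 n : Z2) : mod2 c0 ->
  Z2toQ2 (affine_conj c0 c1 n) =
    (1 - Z2toQ2 n * (2 - Z2toQ2 c1)) / (2 - Z2toQ2 c0).
Proof.
move=> /unit_2sub u0.
by rewrite /affine_conj rmorph_div // !(rmorphB, rmorphM, rmorph1, rmorph_nat).
Qed.

(** With odd coefficients each branch is even on its own residue class, so the digit subtracted
    before halving is 0. *)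
Lemma double_fibred_fun (F : fibred) (c0 c1 n : Z2) :
  mod2 c0 -> mod2 c1 ->
  linear_polynomial F 0 (Z2toQ2 c0) 1 (Z2toQ2 c1) ->
  2 * fibred_fun F n = if mod2 n then 1 + c1 * n else c0 * n.
Proof.
move=> odd0 odd1 hF.
have FE : F (mod2 n) n = if mod2 n then 1 + c1 * n else c0 * n.
  apply: Z2toQ2_inj; rewrite hF.
  by case: (mod2 n); rewrite ?rmorphD ?rmorphM ?rmorph1 ?add0r.
rewrite /fibred_fun half_even FE //.
case: ifP => n2; last by rewrite mod2M odd0 n2.
by rewrite mod2D (mod2_nat 1) mod2M odd1 n2.
Qed.

(** The parity flip makes the branch of G at the image carry the same linear coefficient as the
    branch of F at n. Both sides are compared after multiplication by 2 (2 - c0). *)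
Lemma fibred_fun_affine_conj (F G : fibred) (c0 c1 n : Z2) :
  mod2 c0 -> mod2 c1 ->
  linear_polynomial F 0 (Z2toQ2 c0) 1 (Z2toQ2 c1) ->
  linear_polynomial G 0 (Z2toQ2 c1) 1 (Z2toQ2 c0) ->
  fibred_fun G (affine_conj c0 c1 n) = affine_conj c0 c1 (fibred_fun F n).
Proof.
move=> odd0 odd1 hF hG; have u0 := unit_2sub _ odd0.
have two_neq0 : 2 != 0 :> Z2 by rewrite Z2_natr_eq0.
apply: (mulfI two_neq0); rewrite (double_fibred_fun _ c1 c0) //.
rewrite mod2_affine_conj //; apply: (mulIr u0).
rewrite -[in RHS]mulrA affine_conj_mul //.
have -> : 2 * (1 - fibred_fun F n * (2 - c1)) =
  2 - 2 * fibred_fun F n * (2 - c1) by ring.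
rewrite (double_fibred_fun _ c0 c1) //; case: (mod2 n) => /=.
  (* n odd: both sides are c1 (1 - n (2 - c1)). *)
  by rewrite -(mulrA _ (affine_conj _ _ _)) affine_conj_mul //; ring.
(* n even: both sides are 2 - c0 n (2 - c1). *)
rewrite mulrDl mul1r -(mulrA _ (affine_conj _ _ _)) affine_conj_mul //.
by ring.
Qed.

Lemma psi_affine_conj (F G : fibred) (c0 c1 n : Z2) :
  mod2 c0 -> mod2 c1 ->
  linear_polynomial F 0 (Z2toQ2 c0) 1 (Z2toQ2 c1) ->
  linear_polynomial G 0 (Z2toQ2 c1) 1 (Z2toQ2 c0) ->
  psi G (affine_conj c0 c1 n) = negb \o psi F n.
Proof.
move=> odd0 odd1 hF hG; apply/funext => k /=; rewrite /psi.
have -> : iter k (fibred_fun G) (affine_conj c0 c1 n) =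
    affine_conj c0 c1 (iter k (fibred_fun F) n).
  by elim: k => //= k ->; exact: fibred_fun_affine_conj.
exact: mod2_affine_conj.
Qed.

Lemma rational_affine_conj (c0 c1 n : Z2) : mod2 c0 ->
  rational_Z2 c0 -> rational_Z2 c1 -> rational_Z2 n ->
  rational_Z2 (affine_conj c0 c1 n).
Proof.
move=> odd0 q0 q1 qn; rewrite /rational_Z2 /= Z2toQ2_affine_conj //.
have q2 := rationals_nat 2.
apply: rationalsM; last by apply: rationalsV; exact: rationalsB.
apply: rationalsB; first exact: (rationals_nat 1).
by apply: rationalsM => //; exact: rationalsB.
Qed.

(** * Transfer of ultimate periodicity, and the conclusion *)

Lemma ultimately_periodic_negb s :
  ultimately_periodic (negb \o s) <-> ultimately_periodic s.
Proof.
by split=> -[N [p [p0 sP]]]; exists N, p; split=> // k /sP /=;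
  [move/negb_inj | move->].
Qed.

Lemma ultimately_periodic_on_conj (F G : fibred) (A : set Z2) (h : Z2 -> Z2) :
  (forall m, psi F (h m) = negb \o psi G m) -> (forall m, A (h m) <-> A m) ->
  ultimately_periodic_on F A -> ultimately_periodic_on G A.
Proof.
move=> psih Ah upF; apply/seteqP; split=> m /= mP.
  apply/Ah; rewrite -upF /= psih.
  exact/ultimately_periodic_negb.
apply/ultimately_periodic_negb; rewrite -psih.
by move/Ah: mP; rewrite -[in X in X -> _]upF.
Qed.

Theorem theorem7p16 (b0 b1 : Q2) (F G : fibred)
  (hF : linear_polynomial F 0 b0 1 b1)
  (hG : linear_polynomial G 0 b1 1 b0)
  (sysF : two_adic_system F) (sysG : two_adic_system G) :
  (forall n : Z2,
     Z2toQ2 (pi_conj F negb G n) = (1 + Z2toQ2 n * (b1 - 2)) / (2 - b0)) /\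
  ((rationals `&` range Z2toQ2) b0 -> (rationals `&` range Z2toQ2) b1 ->
     pi_conj F negb G @` rational_Z2 = rational_Z2 /\
     (ultimately_periodic_on F rational_Z2 <->
      ultimately_periodic_on G rational_Z2)).
Proof.
have [c0 odd0 b0E] := even_coef_odd _ _ _ _ hF sysF.
(* The even branch of G carries [b1], so G yields for [b1] what F yields for [b0]. *)
have [c1 odd1 b1E] := even_coef_odd _ _ _ _ hG sysG.
subst b0 b1.
have piE : pi_conj F negb G = affine_conj c0 c1.
  by apply/funext => n; rewrite /pi_conj -(psi_affine_conj F G c0 c1) // psiK.
split=> [n|[q0 _] [q1 _]].
  by rewrite piE Z2toQ2_affine_conj // -mulrN opprB.
have K01 := affine_conjK _ _ odd0 odd1; have K10 := affine_conjK _ _ odd1 odd0.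
have Q01 n : rational_Z2 (affine_conj c0 c1 n) <-> rational_Z2 n.
  split; last exact: rational_affine_conj.
  by move/(rational_affine_conj _ _ _ odd1 q1 q0); rewrite K01.
have Q10 n : rational_Z2 (affine_conj c1 c0 n) <-> rational_Z2 n.
  by rewrite -{2}[n]K10; exact: (iff_sym (Q01 _)).
split; last first.
  (* Passing from F to G uses the map from G-points to F-points, which has the coefficients
     exchanged. *)
  split; first by apply: ultimately_periodic_on_conj Q10 => m;
    exact: psi_affine_conj.
  by apply: ultimately_periodic_on_conj Q01 => m; exact: psi_affine_conj.
rewrite piE; apply/seteqP; split=> [_ [n /Q01 qn <-] //|n /Q10 qn].
by exists (affine_conj c1 c0 n).
Qed.
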